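(* Let $\boldsymbol\mu=(\mu_1,\dots,\mu_K)\in\dot b(\Theta)^K$ with $\mu_1>\mu_2\ge\dots\ge\mu_K$. For every $a\in\{1,\dots,K\}$, $$w_a^*(\boldsymbol\mu)=\frac{x_a(y^* )}{\sum_{i=1}^K x_i(y^* )},$$ where $y^*$ is the unique solution of the equation $F_{\boldsymbol\mu}(y)=1$, and where $$F_{\boldsymbol\mu}:y\mapsto\sum_{a=2}^K\frac{d\left(\mu_1,\frac{\mu_1+x_a(y)\mu_a}{1+x_a(y)}\right)}{d\left(\mu_a,\frac{\mu_1+x_a(y)\mu_a}{1+x_a(y)}\right)}$$ is a continuous, increasing function on $[0,d(\mu_1,\mu_2))$ such that $F_{\boldsymbol\mu}(0)=0$ and $F_{\boldsymbol\mu}(y)\to\infty$ when $y\to d(\mu_1,\mu_2)$.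
   Context: Let $K\ge2$. Exponential family: $\Theta\subset\mathbb R$ is an open interval, $\xi$ is a reference measure on $\mathbb R$, $b:\Theta\to\mathbb R$ is convex and twice differentiable, and $\nu_\theta$ is the probability distribution with density $\frac{d\nu_\theta}{d\xi}(x)=\exp(\theta x-b(\theta))$. Its mean is $\dot b(\theta)$, and for each $\mu\in\dot b(\Theta)$ there is a unique distribution $\nu^\mu$ of the family with mean $\mu$. The divergence function is $d(\mu,\mu')=\mathrm{KL}(\nu^\mu,\nu^{\mu'})=b(\theta')-b(\theta)-\dot b(\theta)(\theta'-\theta)$ when $\mu=\dot b(\theta)$, $\mu'=\dot b(\theta')$. $\mathcal S$ is the set of $\boldsymbol\lambda\in\dot b(\Theta)^K$ having a unique maximal coordinate, whose index is denoted $a^*(\boldsymbol\lambda)$; $\mathrm{Alt}(\boldsymbol\mu)=\{\boldsymbol\lambda\in\mathcal S:a^*(\boldsymbol\lambda)\ne a^*(\boldsymbol\mu)\}$; $\Sigma_K=\{w\in\mathbb R_+^K:\sum_a w_a=1\}$; and $$w^*(\boldsymbol\mu)=\operatorname{argmax}_{w\in\Sigma_K}\ \inf_{\boldsymbol\lambda\in\mathrm{Alt}(\boldsymbol\mu)}\sum_{a=1}^K w_a d(\mu_a,\lambda_a).$$ For $\alpha\in[0,1]$ let $I_\alpha(\mu_1,\mu_2)=\alpha d(\mu_1,\alpha\mu_1+(1-\alpha)\mu_2)+(1-\alpha)d(\mu_2,\alpha\mu_1+(1-\alpha)\mu_2)$. For $a\in\{2,\dots,K\}$ let $g_a(x)=(1+x)I_{1/(1+x)}(\mu_1,\mu_a)$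 for $x\ge0$, which is a strictly increasing bijection from $[0,\infty)$ onto $[0,d(\mu_1,\mu_a))$; $x_a=g_a^{-1}:[0,d(\mu_1,\mu_a))\to[0,\infty)$ is its inverse. $x_1$ denotes the function constantly equal to $1$. *)

(* Defs.v *)
From HB Require Import structures.
From mathcomp Require Import all_boot all_order all_algebra.
From mathcomp Require Import all_classical all_reals all_analysis.

Set Implicit Arguments.
Unset Strict Implicit.
Unset Printing Implicit Defensive.

Import Order.TTheory GRing.Theory Num.Theory.
Import numFieldNormedType.Exports.

Local Open Scope ring_scope.
Local Open Scope classical_set_scope.

Definition KL {d : measure_display} {T : measurableType d} {R : realType}
    (P Q : probability T R) : \bar R :=
  if pselect (P `<< Q) then
    (\int[P]_x (ln (fine (Radon_Nikodym (charge_of_finite_measure P) Q x)))%:E)%E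
  else +oo%E.

(* The values of [b] and [nu] outside [Theta] are irrelevant. *)
Definition exponential_family {R : realType} (Theta : set R)
    (xi : {measure set (measurableTypeR R) -> \bar R}) (b : R -> R)
    (nu : R -> probability (measurableTypeR R) R) : Prop :=
  [/\ open Theta /\ is_interval Theta,
      convex_function Theta b,
      forall theta, Theta theta ->
        derivable b theta 1 /\ derivable b^`() theta 1 &
      forall theta, Theta theta ->
        forall A : set (measurableTypeR R), measurable A ->
          nu theta A = (\int[xi]_(x in A) (expR (theta * x - b theta))%:E)%E].

Section Divergence.
Context {R : realType}.
Variables (Theta : set R) (nu : R -> probability (measurableTypeR R) R).

(* The member of the family with mean [m]; arbitrary if there is none. *)
Definition nu_mean (m : R) : probability (measurableTypeR R) R :=
  nu (xget 0 [set theta | Theta theta /\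
                ('E_(nu theta)[(fun x : R => x)] = m%:E)%E]).

(* [fine] maps +oo to 0, but the divergence is finite between two members of
   an exponential family. *)
Definition divergence (m m' : R) : R := fine (KL (nu_mean m) (nu_mean m')).

Definition I_ (alpha m1 m2 : R) : R :=
  alpha * divergence m1 (alpha * m1 + (1 - alpha) * m2)
  + (1 - alpha) * divergence m2 (alpha * m1 + (1 - alpha) * m2).

Definition g (m1 ma x : R) : R := (1 + x) * I_ (1 + x)^-1 m1 ma.

(* The inverse of [g m1 ma] viewed as a function on [0, +oo[; arbitrary (0)
   outside its range. *)
Definition g_inv (m1 ma : R) : R -> R :=
  'pinv_(fun=> 0) [set x | 0 <= x] (g m1 ma).

End Divergence.

(* Arms are numbered from 0: the first arm is 0 and the second arm is 1. *)
Definition arm1 {K : nat} (hK : (2 <= K)%N) : 'I_K := Ordinal (ltnW hK).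
Definition arm2 {K : nat} (hK : (2 <= K)%N) : 'I_K := Ordinal hK.

Section Bandit.
Context {R : realType} {K : nat}.
Variables (hK : (2 <= K)%N) (Theta : set R) (b : R -> R)
          (nu : R -> probability (measurableTypeR R) R).
Implicit Types (mu lam w : 'I_K -> R).

Local Notation d := (divergence Theta nu).

Definition mean_space : set R := b^`() @` Theta.

Definition bandit_models : set ('I_K -> R) :=
  [set lam | (forall a, mean_space (lam a)) /\
             (exists! a, forall c, lam c <= lam a)].

Definition astar lam : 'I_K := [arg max_(a > arm1 hK) lam a]%O.

Definition Alt mu : set ('I_K -> R) :=
  [set lam | bandit_models lam /\ astar lam <> astar mu].

Definition simplex : set ('I_K -> R) :=
  [set w | (forall a, 0 <= w a) /\ \sum_a w a = 1].

Definition objective mu w : \bar R :=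
  ereal_inf [set (\sum_a w a * d (mu a) (lam a))%:E | lam in Alt mu].

(* The argmax, as the set of all maximisers. *)
Definition wstar mu : set ('I_K -> R) :=
  [set w | simplex w /\
           forall v, simplex v -> (objective mu v <= objective mu w)%E].

Definition x_ mu (a : 'I_K) (y : R) : R :=
  if a == arm1 hK then 1 else g_inv Theta nu (mu (arm1 hK)) (mu a) y.

Definition F mu (y : R) : R :=
  \sum_(a | a != arm1 hK)
    let m := (mu (arm1 hK) + x_ mu a y * mu a) / (1 + x_ mu a y) in
    d (mu (arm1 hK)) m / d (mu a) m.

End Bandit.

(* Main.v *)
Require Import Defs.
From HB Require Import structures.
From mathcomp Require Import all_boot all_order all_algebra.
From mathcomp Require Import all_classical all_reals all_analysis.
From mathcomp Require Import measurable_realfun.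
From mathcomp Require Import ring lra.
Set Implicit Arguments.
Unset Strict Implicit.
Unset Printing Implicit Defensive.
Import Order.TTheory GRing.Theory Num.Theory.
Import numFieldNormedType.Exports.
Local Open Scope ring_scope.
Local Open Scope classical_set_scope.

(** The mean parametrization turns the divergence into a Bregman divergence
    [d m x = phi x - m * tau x - psi m], where [tau] inverts [b'].  For an
    exponential family this comes down to the inequality [1 + u <= expR u],
    integrated against [nu th] with [u] the log-likelihood ratio of [th'] and
    [th]: it says that [b] lies above the line through [(th, b th)] whose slope
    is the mean of [nu th].  Hence this mean is [b' th], and equality away from
    [th] would make the identity a.e. constant, so that [b'] would be constant,
    which [mu_2 < mu_1] excludes.

    The Bregman form gives the barycenter identity [bregman_barycenter]:
    [w1 d(m1, x) + w2 d(m2, x)] exceeds its value at the barycenter [m] of [m1],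
    [m2] by [(w1 + w2) d(m, x)].  With the positivity of [d] it yields the
    monotonicity of [d m], and it shows that [g_a(x)] is the infimum over [z] of
    [d(mu_1, z) + x d(mu_a, z)], attained only at the barycenter of weights
    [1, x].  With the continuity of [d m], everything about [g_a], its inverse
    [x_a] and the ratios summed in [F] follows.

    For the weights, the infimum over the alternatives splits into pairs of
    arms: it is the infimum over [a <> 1] and over [x] of the cost
    [w_1 d(mu_1, x) + w_a d(mu_a, x)] ([objective_ge], [objective_le]), since a
    model whose best arm is not the first has some arm [a] above arm 1, and
    moving both of these to a common mean is the cheapest way to get there.  Let
    [z_a] be the barycenters given by the weights [x_a(y)].  Giving arm [a] the
    coefficient [1 / d(mu_a, z_a)], the equation [F y = 1] says exactly that the
    combination of the pair costs at the [z_a] equals [\sum_a w_a], hence 1 on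
    the simplex ([weighted_costs]).  So the smallest of these costs is at most
    their weighted mean, a value independent of [w], and the weights
    [x_a(y) / \sum_i x_i(y)] reach it, because they make all the pair costs
    equal to [y / \sum_i x_i(y)] and each [z_a] optimal.  Another maximiser must
    also make all these costs equal, so each [z_a] is the barycenter for its
    weights too, which forces [w_a = w_1 x_a(y)]. *)

(** * Change of density *)

Section density.
Context d (T : measurableType d) (R : realType).
Variables (mu nu : {measure set T -> \bar R}) (p : T -> R).
Hypothesis p0 : forall x, 0 <= p x.
Hypothesis mp : measurable_fun setT p.
Hypothesis nuE : forall A, measurable A -> nu A = (\int[mu]_(x in A) (p x)%:E)%E.

Import HBNNSimple.
Local Open Scope ereal_scope.

Let density_nnsfun (h : {nnsfun T >-> R}) :
  \int[nu]_x (h x)%:E = \int[mu]_x ((h x)%:E * (p x)%:E).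
Proof.
have mpE : measurable_fun setT (fun x => (p x)%:E) by exact/measurable_EFinP.
have mh y : measurable (h @^-1` [set y]) by exact: measurable_sfunP.
under eq_integral do rewrite fimfunE -fsumEFin//.
rewrite ge0_integral_fsum//; last first.
- by move=> y x _; exact: nnfun_muleindic_ge0.
- by move=> y; apply/measurable_EFinP; exact: measurable_funM.
under [RHS]eq_integral => x _.
  rewrite fimfunE -fsumEFin// ge0_mule_fsuml; last first.
    by move=> y; exact: nnfun_muleindic_ge0.
  over.
rewrite ge0_integral_fsum//; last first.
- move=> y x _; apply: mule_ge0; last by rewrite lee_fin.
  exact: nnfun_muleindic_ge0.
- move=> y; apply: emeasurable_funM => //.
  by apply/measurable_EFinP; exact: measurable_funM.
apply: eq_fsbigr => y; rewrite inE => -[t _ <-].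
rewrite integralZl_indic_nnsfun// integral_indic// setIT nuE//.
rewrite integral_mkcond -ge0_integralZl//; last 3 first.
- by apply/(measurable_restrictT _ (mh _)); exact: measurable_funTS.
- by move=> x _; rewrite patchE; case: ifP => //; rewrite lee_fin.
- by rewrite lee_fin.
apply: eq_integral => x _; rewrite EFinM -muleA epatch_indic/=.
by rewrite [X in _ * X = _]muleC.
Qed.

(** By monotone convergence it suffices to treat simple functions.  The measure
    [mu] stands for a reference measure, possibly not sigma-finite, so [p] cannot
    be traded for a Radon-Nikodym derivative. *)
Lemma ge0_integral_density f : (forall x, 0 <= f x) ->
  measurable_fun setT f -> \int[nu]_x f x = \int[mu]_x (f x * (p x)%:E).
Proof.
move=> f0 mf; pose h := nnsfun_approx measurableT mf.
have hf x : EFin (h n x) @[n --> \oo] --> f x by exact: cvg_nnsfun_approx.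
have hnd x a b : (a <= b)%N -> (h a x <= h b x)%R.
  by move=> ab; exact/lefP/nd_nnsfun_approx.
transitivity (limn (fun n => \int[nu]_x (h n x)%:E)).
  rewrite -monotone_convergence//.
  - by apply: eq_integral => x _; apply/esym/cvg_lim.
  - by move=> n; exact/measurable_EFinP.
  - by move=> n x _; rewrite lee_fin.
  - by move=> x _ a b ab; rewrite lee_fin hnd.
under eq_fun do rewrite density_nnsfun.
rewrite -monotone_convergence//.
- apply: eq_integral => x _; apply/cvg_lim => //.
  by apply: cvgeZr => //; exact: hf.
- by move=> n; apply: emeasurable_funM; exact/measurable_EFinP.
- by move=> n x _; rewrite mule_ge0 ?lee_fin.
- by move=> x _ a b ab; rewrite lee_wpmul2r ?lee_fin ?hnd.
Qed.

End density.

Lemma null_dominates_density d (T : measurableType d) (R : realType)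
    (mu nu : {measure set T -> \bar R}) (p : T -> R) :
  (forall A, measurable A -> nu A = (\int[mu]_(x in A) (p x)%:E)%E) ->
  measurable_fun setT p -> nu `<< mu.
Proof.
move=> nuE mp; apply/null_content_dominatesP => A mA muA0.
rewrite nuE//; apply: null_set_integral => //.
exact/measurable_funTS/measurable_EFinP.
Qed.

(** The Radon-Nikodym derivative chosen in [KL] agrees with the given density
    only [Q]-a.e.; since [P] is dominated by [Q] this suffices. *)
Lemma KL_density d (T : measurableType d) (R : realType)
    (P Q : probability T R) (r : T -> R) :
  measurable_fun setT r ->
  (forall A, measurable A -> P A = (\int[Q]_(x in A) (r x)%:E)%E) ->
  KL P Q = (\int[P]_x (ln (r x))%:E)%E.
Proof.
move=> mr PE.
have PQ : P `<< Q by exact: null_dominates_density PE mr.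
rewrite /KL; case: pselect => // PQ'.
set f := Radon_Nikodym _ _.
have fint : Q.-integrable setT f by exact: Radon_Nikodym_integrable.
have fr : ae_eq Q setT f (EFin \o r).
  apply: integral_ae_eq => //; first exact/measurable_EFinP.
  by move=> E _ mE; rewrite -Radon_Nikodym_integral// -PE.
apply: ae_eq_integral => //.
- apply/measurable_EFinP; apply: measurableT_comp => //.
  by apply: measurableT_comp => //; exact: measurable_int fint.
- by apply/measurable_EFinP; exact: measurableT_comp.
have := null_dominates_ae_eq measurableT PQ fr.
by apply: filterS => x /= + _ => ->.
Qed.

(** * The divergence of an exponential family *)

Section exponential_family_theory.
Context {R : realType} (Theta : set R).
Variables (xi : {measure set (measurableTypeR R) -> \bar R}) (b : R -> R).
Variable nu : R -> probability (measurableTypeR R) R.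
Hypothesis hfam : exponential_family Theta xi b nu.

Local Notation b' := (derive1 b).
Local Notation likelihood th th' x := ((th' - th) * x - (b th' - b th)).

Lemma measurable_likelihood (c e : R) :
  measurable_fun [set: measurableTypeR R] (fun x : R => expR (c * x - e)).
Proof.
by apply: measurableT_comp => //; apply: measurable_funB => //.
Qed.

(** Comparing two members of the family directly removes [xi] from all that
    follows. *)
Lemma expfam_density th th' : Theta th -> Theta th' ->
  forall A : set (measurableTypeR R), measurable A ->
    nu th' A = (\int[nu th]_(x in A) (expR (likelihood th th' x))%:E)%E.
Proof.
case: hfam => _ _ _ nuE thT th'T A mA.
pose p (x : measurableTypeR R) := expR (th * x - b th).
have m1 := measurable_likelihood (th' - th) (b th' - b th).
rewrite (nuE th')// integral_mkcond [RHS]integral_mkcond.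
rewrite (@ge0_integral_density _ _ _ xi (nu th) p)//.
- apply: eq_integral => x _; rewrite !patchE; case: ifP => _; last by rewrite mul0e.
  by rewrite -EFinM -expRD; congr (expR _)%:E; ring.
- by move=> x; exact: expR_ge0.
- exact: measurable_likelihood.
- exact: nuE.
- by move=> x; rewrite patchE; case: ifP => // _; rewrite lee_fin expR_ge0.
- apply/(measurable_restrictT _ mA).
  exact/measurable_funTS/measurable_EFinP.
Qed.

Lemma expfam_integral_likelihood th th' : Theta th -> Theta th' ->
  (\int[nu th]_x (expR (likelihood th th' x))%:E = 1)%E.
Proof.
by move=> thT th'T; rewrite -expfam_density ?probability_setT.
Qed.

Lemma expfam_integrable_likelihood th th' : Theta th -> Theta th' ->
  (nu th).-integrable setT (fun x : R => (expR (likelihood th th' x))%:E).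
Proof.
move=> thT th'T; apply/integrableP; split.
  by apply/measurable_EFinP; exact: measurable_likelihood.
under eq_integral do rewrite gee0_abs ?lee_fin ?expR_ge0//.
by rewrite expfam_integral_likelihood// ltry.
Qed.

Lemma expfam_integrable_expR th c : Theta th -> Theta (th + c) ->
  (nu th).-integrable setT (fun x : R => (expR (c * x))%:E).
Proof.
move=> thT th'T; pose k := b (th + c) - b th.
have := integrableZl measurableT (expR k) (expfam_integrable_likelihood thT th'T).
apply: eq_integrable => // x _.
by rewrite -EFinM -expRD; congr (expR _)%:E; rewrite /k; ring.
Qed.

(** [|x|] is dominated by [(exp (c x) + exp (- c x)) / c], and both exponentials
    are integrable once [th + c] and [th - c] are parameters. *)
Lemma expfam_integrable_id th : Theta th ->
  (nu th).-integrable setT (fun x : R => x%:E).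
Proof.
move=> thT; case: hfam => -[oT _] _ _ _.
have [e /= e0 eT] := (nbhs_ballP _ _).1 (open_nbhs_nbhs (conj oT thT)).
pose c := e / 2; have c0 : 0 < c by rewrite divr_gt0.
have ce : c < e by rewrite ltr_pdivrMr// ltr_pMr// ltr1n.
have int1 : (nu th).-integrable setT (fun x : R => (expR (c * x))%:E).
  apply: expfam_integrable_expR => //; apply: eT.
  by rewrite /ball/= opprD addNKr normrN gtr0_norm.
have int2 : (nu th).-integrable setT (fun x : R => (expR (- c * x))%:E).
  apply: expfam_integrable_expR => //; apply: eT.
  by rewrite /ball/= opprD addNKr opprK gtr0_norm.
have := integrableZl measurableT c^-1 (integrableD measurableT int1 int2).
apply: le_integrable => //; first exact/measurable_EFinP.
move=> x _; rewrite -EFinD -EFinM !abse_EFin lee_fin.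
rewrite [leRHS]ger0_norm ?mulr_ge0 ?addr_ge0 ?expR_ge0 ?invr_ge0 ?(ltW c0)//.
rewrite ler_pdivlMl// -[X in X * _](gtr0_norm c0) -normrM.
have h1 := expR_ge1Dx (c * x); have h2 := expR_ge1Dx (- c * x).
have e1 := expR_ge0 (c * x); have e2 := expR_ge0 (- c * x).
by rewrite ler_norml; apply/andP; split; lra.
Qed.

Definition expfam_mean th : R := fine (\int[nu th]_x (x : R)%:E)%E.

Lemma expfam_integral_affine th a e : Theta th ->
  (\int[nu th]_x (a * x - e : R)%:E = (a * expfam_mean th - e)%:E)%E.
Proof.
move=> thT; have ix := expfam_integrable_id thT.
have iax := integrableZl measurableT a ix.
have ie := finite_measure_integrable_cst (nu th) e measurableT.
under eq_integral do rewrite EFinB.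
rewrite [LHS](@integralB_EFin _ _ _ (nu th) setT (fun x : R => a * x) (cst e))//.
under eq_integral do rewrite EFinM.
rewrite integralZl//.
rewrite [X in (_ - X)%E](integral_cst (nu th) measurableT e%:E).
rewrite [X in (_ - _ * X)%E](_ : _ = 1%E); last exact: probability_setT.
rewrite mule1 EFinB EFinM.
by rewrite /expfam_mean fineK//; exact: integrable_fin_num.
Qed.

(** The likelihood ratio has integral 1, so the integral of [expR u - (1 + u)] is
    minus that of [u], an affine function of the observation. *)
Lemma expfam_integral_tangent_gap th th' : Theta th -> Theta th' ->
  (\int[nu th]_x
     (expR (likelihood th th' x) - (1 + likelihood th th' x) : R)%:E
   = (b th' - b th - expfam_mean th * (th' - th))%:E)%E.
Proof.
move=> thT th'T; have ie := expfam_integrable_likelihood thT th'T.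
pose a := th' - th; pose k := b th' - b th - 1.
have ia : (nu th).-integrable setT (fun x : R => (a * x - k)%:E).
  have ix := integrableZl measurableT a (expfam_integrable_id thT).
  have ik := finite_measure_integrable_cst (nu th) k measurableT.
  by apply: (eq_integrable measurableT _ _ _ (integrableB measurableT ix ik)).
transitivity (\int[nu th]_x
    ((expR (likelihood th th' x))%:E - (a * x - k : R)%:E))%E.
  by apply: eq_integral => x _; rewrite -EFinB; congr EFin; rewrite /a /k; ring.
rewrite [LHS](@integralB_EFin _ _ _ (nu th) setT
  (fun x => expR (likelihood th th' x)) (fun x : R => a * x - k))//.
rewrite expfam_integral_likelihood// expfam_integral_affine// -EFinB.
by congr EFin; rewrite /a /k; ring.
Qed.

Lemma expfam_gap_ge0 th th' : Theta th -> Theta th' ->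
  0 <= b th' - b th - expfam_mean th * (th' - th).
Proof.
move=> thT th'T; rewrite -lee_fin -expfam_integral_tangent_gap//.
by apply: integral_ge0 => x _; rewrite lee_fin subr_ge0 expR_ge1Dx.
Qed.

(** The slope of a supporting line of a differentiable function is its
    derivative; this replaces differentiation under the integral sign. *)
Lemma expfam_meanE th : Theta th -> expfam_mean th = b' th.
Proof.
move=> thT; case: hfam => -[oT _] _ db _.
have [e /= e0 eT] := (nbhs_ballP _ _).1 (open_nbhs_nbhs (conj oT thT)).
pose f t := b t - expfam_mean th * t.
have inT t : t \in `]th - e, th + e[%R -> Theta t.
  rewrite in_itv/= => /andP[t1 t2]; apply: eT.
  by rewrite /ball/= ltr_norml; apply/andP; split; lra.
have db1 t : Theta t -> is_derive t 1 b (b' t).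
  by move=> /db[d1 _]; rewrite derive1E; exact: derivableP.
have df t : Theta t -> is_derive t 1 f (b' t - expfam_mean th).
  move=> tT; have := db1 _ tT => ?; rewrite /f.
  apply: is_derive_eq; rewrite /GRing.scale/=; ring.
have : is_derive th 1 f 0.
  apply: (@derive1_at_min _ f (th - e) (th + e)).
  - lra.
  - by move=> t /inT /df[].
  - by rewrite in_itv/=; apply/andP; split; lra.
  - move=> t /inT tT; have := expfam_gap_ge0 thT tT; rewrite /f; lra.
by case: (df _ thT) => _ df0 [_]; rewrite df0 => /eqP; rewrite subr_eq0 => /eqP.
Qed.

Lemma expfam_expectation th : Theta th ->
  ('E_(nu th)[(fun x : R => x)] = (b' th)%:E)%E.
Proof.
move=> thT; rewrite expectation.unlock -expfam_meanE// /expfam_mean fineK//.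
by apply: integrable_fin_num => //; exact: expfam_integrable_id.
Qed.

(** In the equality case the log-likelihood ratio vanishes a.e., so the
    observation is a.e. a constant [c]; as the members of the family dominate one
    another, all of them would then have mean [c]. *)
Lemma expfam_gap_gt0 th th' : (exists m m', [/\ mean_space Theta b m,
    mean_space Theta b m' & m <> m']) ->
  Theta th -> Theta th' -> th != th' ->
  0 < b th' - b th - b' th * (th' - th).
Proof.
move=> [_ [_ [[t1 t1T <-] [t2 t2T <-] bt12]]] thT th'T thth'.
rewrite -expfam_meanE// lt_neqAle expfam_gap_ge0// andbT eq_sym; apply/eqP => gap0.
have := expfam_integral_tangent_gap thT th'T; rewrite gap0.
set f := (X in (\int[_]_x (X x)%:E)%E) => int0.
have f0 x : 0 <= f x by rewrite /f subr_ge0 expR_ge1Dx.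
have mf : measurable_fun [set: measurableTypeR R] f.
  apply: measurable_funB; first exact: measurable_likelihood.
  by apply: measurable_funD => //; apply: measurable_funB => //.
pose c := (b th' - b th) / (th' - th).
have aec : ae_eq (nu th) setT (fun x : measurableTypeR R => (x : R)%:E) (cst c%:E).
  have : ae_eq (nu th) setT (EFin \o f) (cst 0%E).
    apply/ae_eq_integral_abs => //; first exact/measurable_EFinP.
    by under eq_integral do rewrite /= ger0_norm//.
  apply: filterS => x /= + _ => /(_ Logic.I) [] fx0.
  congr EFin; apply/eqP; rewrite /c eq_sym; apply: contraT => xc.
  have /expR_gt1Dx : likelihood th th' x != 0.
    apply: contra xc; rewrite subr_eq0 => /eqP <-.
    by rewrite mulrAC divff ?mul1r// subr_eq0 eq_sym.
  by move: fx0; rewrite /f => /eqP; rewrite subr_eq0 => /eqP ->; rewrite ltxx.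
suff bc t : Theta t -> b' t = c by apply: bt12; rewrite !bc.
move=> tT; rewrite -expfam_meanE// /expfam_mean.
rewrite (@ae_eq_integral _ _ _ (nu t) setT (cst c%:E))//.
- by rewrite integral_cst//= [X in (_ * X)%E](_ : _ = 1%E) ?mule1//; exact: probability_setT.
- apply: null_dominates_ae_eq aec => //.
  exact: null_dominates_density (expfam_density thT tT) (measurable_likelihood _ _).
Qed.

Lemma expfam_KL th th' : Theta th -> Theta th' ->
  KL (nu th) (nu th') = (b th' - b th - b' th * (th' - th))%:E.
Proof.
move=> thT th'T.
rewrite (KL_density (measurable_likelihood _ _) (expfam_density th'T thT)).
under eq_integral do rewrite expRK.
by rewrite expfam_integral_affine// expfam_meanE//; congr EFin; ring.
Qed.

Lemma divergence_bregman th th' : {in Theta &, injective b'} ->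
  Theta th -> Theta th' ->
  divergence Theta nu (b' th) (b' th') =
  b th' - b th - b' th * (th' - th).
Proof.
move=> injb thT th'T; rewrite /divergence.
suff nu_meanE t : Theta t -> nu_mean Theta nu (b' t) = nu t.
  by rewrite !nu_meanE// expfam_KL.
move=> tT; rewrite /nu_mean; case: xgetP => [s -> [sT] | /(_ t)].
  by rewrite expfam_expectation// => -[/injb ->]//; rewrite inE.
by case; split => //; exact: expfam_expectation.
Qed.

End exponential_family_theory.

(** * Bregman divergences in the mean parametrization *)

(** If [h] takes a value beyond [h y0 + e], then [h y0 + e] lies in the interval
    [A], and [h y < h y0 + e] for every [y < f (h y0 + e)], hence for [y] near [y0];
    likewise below.  This gives one-sided continuity at an end point of [B]. *)
Lemma within_continuous_inverse {R : realType} (A B : set R) (f h : R -> R) :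
  is_interval A ->
  (forall s t, A s -> A t -> s < t -> f s < f t) ->
  (forall y, B y -> A (h y) /\ f (h y) = y) ->
  {within B, continuous h}.
Proof.
move=> Aitv fmono hB; apply/subspace_continuousP => y0 By0.
have hlt s y : A s -> B y -> (f s < y -> s < h y) /\ (y < f s -> h y < s).
  move=> As By; have [Ahy fhy] := hB y By; rewrite -{1 3}fhy.
  split; case: (ltgtP s (h y)) => // [ls|<-]; rewrite ?ltxx//.
    by have := fmono _ _ Ahy As ls; case: ltgtP.
  by have := fmono _ _ As Ahy ls; case: ltgtP.
have [Ah0 fh0] := hB _ By0.
apply/cvgrPdist_lt => e e0; rewrite near_withinE.
have upper : \forall y \near y0, B y -> h y < h y0 + e.
  have [[y1 [By1 hy1]]|nex] := pselect (exists y1, B y1 /\ h y0 + e <= h y1).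
    have As : A (h y0 + e).
      apply: (Aitv (h y0) (h y1)) => //; first by have [] := hB _ By1.
      by rewrite hy1 lerDl ltW.
    have y0f : y0 < f (h y0 + e) by rewrite -{1}fh0 fmono// ltrDl.
    by near=> y => By; apply: (hlt _ _ As By).2; near: y; exact: lt_nbhsl.
  by near=> y => By; rewrite ltNge; apply/negP => hy; apply: nex; exists y.
have lower : \forall y \near y0, B y -> h y0 - e < h y.
  have [[y1 [By1 hy1]]|nex] := pselect (exists y1, B y1 /\ h y1 <= h y0 - e).
    have As : A (h y0 - e).
      apply: (Aitv (h y1) (h y0)) => //; first by have [] := hB _ By1.
      by rewrite hy1 gerBl ltW.
    have fy0 : f (h y0 - e) < y0 by rewrite -{2}fh0 fmono// gtrBl.
    by near=> y => By; apply: (hlt _ _ As By).1; near: y; exact: lt_nbhsr.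
  by near=> y => By; rewrite ltNge; apply/negP => hy; apply: nex; exists y.
near=> y => By.
have u : h y < h y0 + e by move: By; near: y.
have l : h y0 - e < h y by move: By; near: y.
by rewrite ltr_distlC l u.
Unshelve. all: by end_near. Qed.

(** The properties of [d] used below, free of the measures that define it.  For
    the exponential family [phi] is [b] composed with [tau], and [tau m] is the
    parameter whose mean is [m]. *)
Definition bregman_divergence {R : realType} (M : set R) (d : R -> R -> R) :=
  [/\ open M /\ is_interval M,
      (forall m, M m -> d m m = 0),
      (forall m x, M m -> M x -> m != x -> 0 < d m x),
      (forall m x, M m -> M x -> d m y @[y --> x] --> d m x) &
      exists phi tau psi : R -> R,
        forall m x, M m -> M x -> d m x = phi x - m * tau x - psi m].

Lemma expfam_bregman {R : realType} (Theta : set R)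
    (xi : {measure set (measurableTypeR R) -> \bar R}) (b : R -> R)
    (nu : R -> probability (measurableTypeR R) R) :
  exponential_family Theta xi b nu ->
  (exists m m', [/\ mean_space Theta b m, mean_space Theta b m' & m <> m']) ->
  bregman_divergence (mean_space Theta b) (divergence Theta nu).
Proof.
move=> hfam nonconst.
have [[oT iT] _ db _] := hfam.
pose b' := derive1 b.
have gap th th' : Theta th -> Theta th' -> th != th' ->
    0 < b th' - b th - b' th * (th' - th).
  by move=> *; exact: (expfam_gap_gt0 hfam nonconst).
have b'mono s t : Theta s -> Theta t -> s < t -> b' s < b' t.
  move=> sT tT st; have g1 := gap _ _ sT tT (negbT (lt_eqF st)).
  have g2 := gap _ _ tT sT (negbT (gt_eqF st)); rewrite ltNge; apply/negP => ts.
  have : 0 <= (b' s - b' t) * (t - s) by rewrite mulr_ge0// subr_ge0// ltW.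
  by lra.
have b'inj : {in Theta &, injective b'}.
  move=> s t; rewrite !inE => sT tT e; case: (ltgtP s t) => // st.
    by have := b'mono _ _ sT tT st; rewrite e ltxx.
  by have := b'mono _ _ tT sT st; rewrite e ltxx.
pose tau m := xget 0 [set th | Theta th /\ b' th = m].
have tauP m : mean_space Theta b m -> Theta (tau m) /\ b' (tau m) = m.
  by move=> [th thT <-]; rewrite /tau; case: xgetP => // /(_ th) [].
have dE m x : mean_space Theta b m -> mean_space Theta b x ->
    divergence Theta nu m x = b (tau x) - b (tau m) - m * (tau x - tau m).
  move=> /tauP[mT em] /tauP[xT ex].
  by rewrite -{1}em -{1}ex (divergence_bregman hfam)//; rewrite -/b' em.
have iM : is_interval (mean_space Theta b).
  apply/connected_intervalP; apply: connected_continuous_connected.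
    exact/connected_intervalP.
  rewrite continuous_open_subspace// => th; rewrite inE => /db[_ d2].
  by apply: differentiable_continuous; exact/derivable1_diffP.
have oM : open (mean_space Theta b).
  rewrite openE => _ [th thT <-].
  have [e /= e0 eT] := (nbhs_ballP _ _).1 (open_nbhs_nbhs (conj oT thT)).
  have e2 : 0 < e / 2 by rewrite divr_gt0.
  have lT : Theta (th - e / 2).
    by apply: eT; rewrite /ball/= ltr_norml; apply/andP; split; lra.
  have rT : Theta (th + e / 2).
    by apply: eT; rewrite /ball/= ltr_norml; apply/andP; split; lra.
  have l : b' (th - e / 2) < b' th by apply: b'mono => //; lra.
  have r : b' th < b' (th + e / 2) by apply: b'mono => //; lra.
  near=> y; apply: (iM (b' (th - e / 2)) (b' (th + e / 2))).
  - by exists (th - e / 2).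
  - by exists (th + e / 2).
  apply/andP; split; apply/ltW; near: y; [exact: lt_nbhsr|exact: lt_nbhsl].
have tau_cont x : mean_space Theta b x -> tau y @[y --> x] --> tau x.
  move=> xM; have := within_continuous_inverse iT b'mono tauP.
  by rewrite continuous_open_subspace// => /(_ x); apply; rewrite inE.
split => //.
- by move=> m mM; rewrite dE//; ring.
- move=> m x mM xM mx; rewrite dE//.
  have [[mT em] [xT ex]] := (tauP _ mM, tauP _ xM).
  rewrite -{2}em; apply: gap => //; apply: contraNneq mx => tmx.
  by rewrite -em -ex tmx.
- move=> m x mM xM; rewrite dE//.
  have near_eq : \forall y \near x,
      b (tau y) - b (tau m) - m * (tau y - tau m) = divergence Theta nu m y.
    by near=> y; rewrite dE//; near: y; exact: open_nbhs_nbhs.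
  apply: cvg_trans; first exact: near_eq_cvg near_eq.
  have bc : b (tau y) @[y --> x] --> b (tau x).
    apply: continuous_cvg; last exact: tau_cont.
    apply: differentiable_continuous; apply/derivable1_diffP.
    by have [/db[]] := tauP _ xM.
  apply: cvgB; first by apply: cvgB => //; exact: cvg_cst.
  apply: cvgM; first exact: cvg_cst.
  by apply: cvgB; [exact: tau_cont|exact: cvg_cst].
- exists (b \o tau), tau, (fun m => b (tau m) - m * tau m) => m x mM xM.
  by rewrite dE//=; ring.
Unshelve. all: by end_near. Qed.
Section bregman_theory.
Context {R : realType} (M : set R) (d : R -> R -> R).
Hypothesis Hd : bregman_divergence M d.

Lemma bregman_ge0 m x : M m -> M x -> 0 <= d m x.
Proof.
case: Hd => _ d0 dpos _ _ mM xM; have [->|mx] := eqVneq m x; first by rewrite d0.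
by rewrite ltW ?dpos.
Qed.

(** For fixed weights the left-hand side depends on [x] through
    [(w1 + w2) (phi x - m * tau x)] only. *)
Lemma bregman_barycenter w1 w2 m1 m2 m x : M m1 -> M m2 -> M m -> M x ->
  w1 * m1 + w2 * m2 = (w1 + w2) * m ->
  w1 * d m1 x + w2 * d m2 x
  = w1 * d m1 m + w2 * d m2 m + (w1 + w2) * d m x.
Proof.
case: Hd => _ d0 _ _ [phi [tau [psi dE]]] m1M m2M mM xM wm.
have := d0 _ mM; rewrite !dE// => dmm0.
apply/eqP; rewrite -subr_eq0; apply/eqP.
transitivity ((tau m - tau x) * (w1 * m1 + w2 * m2 - (w1 + w2) * m)
  - (w1 + w2) * (phi m - m * tau m - psi m)); first by ring.
by rewrite dmm0 wm; ring.
Qed.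

(** [x] lies strictly between [m] and [y], hence is a barycenter of both:
    [bregman_barycenter], applied to [m] and [y] and evaluated at [y], compares
    [d m y] with [d m x]. *)
Let bregman_mono m x y : M m -> M x -> M y ->
  0 < (y - x) * (x - m) -> d m x < d m y.
Proof.
move=> mM xM yM ymx; have [_ d0 dpos _ _] := Hd.
have xy : x != y by apply: contraTneq ymx => ->; rewrite subrr mul0r ltxx.
have mx : m != x by apply: contraTneq ymx => ->; rewrite subrr mulr0 ltxx.
(* [y - x] and [x - m] up to the common factor [x - m], which makes [w1] positive
   in both orders of the three points. *)
pose w1 := (y - x) * (x - m); pose w2 := (x - m) ^+ 2.
have w2ge : 0 <= w2 by rewrite sqr_ge0.
have wm : w1 * m + w2 * y = (w1 + w2) * x by rewrite /w1 /w2; ring.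
have := bregman_barycenter mM yM xM yM wm.
rewrite (d0 _ yM) mulr0 addr0 => e.
rewrite -(ltr_pM2l ymx) -/w1 e -subr_gt0.
have h1 : 0 <= w2 * d y x by rewrite mulr_ge0// bregman_ge0.
have h2 : 0 < (w1 + w2) * d x y by rewrite mulr_gt0 ?dpos// ltr_wpDr.
lra.
Qed.

Lemma bregman_increasing m x y : M m -> M x -> M y ->
  m <= x -> x < y -> d m x < d m y.
Proof.
move=> mM xM yM; rewrite le_eqVlt => /orP[/eqP <-|mx] xy.
  by case: Hd => _ d0 dpos _ _; rewrite d0// dpos// lt_eqF.
by apply: bregman_mono => //; rewrite mulr_gt0// subr_gt0.
Qed.

Lemma bregman_decreasing m x y : M m -> M x -> M y ->
  x <= m -> y < x -> d m x < d m y.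
Proof.
move=> mM xM yM; rewrite le_eqVlt => /orP[/eqP ->|mx] xy.
  by case: Hd => _ d0 dpos _ _; rewrite d0// dpos// gt_eqF.
by apply: bregman_mono => //; rewrite nmulr_rgt0 ?subr_lt0.
Qed.

End bregman_theory.

(** * The function g and its inverse *)

Definition barycenter {R : realType} (m1 m2 x : R) : R :=
  (m1 + x * m2) / (1 + x).

Section two_arms.
Context {R : realType} (M : set R).
Variables (Theta : set R) (nu : R -> probability (measurableTypeR R) R).
Local Notation d := (divergence Theta nu).
Hypothesis Hd : bregman_divergence M d.
Variables m1 m2 : R.
Hypotheses (m1M : M m1) (m2M : M m2) (m21 : m2 < m1).
Local Notation bary := (barycenter m1 m2).
Local Notation g := (g Theta nu m1 m2).
Local Notation ratio x := (d m1 (bary x) / d m2 (bary x)).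

Let gt0_1D (x : R) : 0 <= x -> 0 < 1 + x. Proof. by move=> x0; rewrite ltr_wpDr. Qed.

Lemma barycenterE (x : R) : 0 <= x -> (1 + x) * bary x = m1 + x * m2.
Proof. by move=> x0; rewrite mulrC divfK// gt_eqF// gt0_1D. Qed.

Lemma barycenter0 : bary 0 = m1.
Proof. by rewrite /barycenter mul0r !addr0 divr1. Qed.

Lemma barycenter_gt (x : R) : 0 <= x -> m2 < bary x.
Proof.
move=> x0; rewrite /barycenter ltr_pdivlMr ?gt0_1D//.
by rewrite mulrDr mulr1 mulrC ltrD2r.
Qed.

Lemma barycenter_decreasing (x y : R) : 0 <= x -> x < y -> bary y < bary x.
Proof.
move=> x0 xy; have y0 := le_trans x0 (ltW xy).
rewrite /barycenter ltr_pdivrMr ?gt0_1D// mulrAC ltr_pdivlMr ?gt0_1D//.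
rewrite -subr_gt0; have : 0 < (y - x) * (m1 - m2) by rewrite mulr_gt0// subr_gt0.
by congr (_ < _); ring.
Qed.

Lemma barycenter_le (x : R) : 0 <= x -> bary x <= m1.
Proof.
rewrite le_eqVlt => /orP[/eqP <-|x0]; first by rewrite barycenter0.
by rewrite ltW// -[ltRHS]barycenter0 barycenter_decreasing.
Qed.

Lemma barycenter_in (x : R) : 0 <= x -> M (bary x).
Proof.
move=> x0; case: Hd => -[_ iM] _ _ _ _; apply: (iM m2 m1) => //.
by rewrite ltW ?barycenter_gt ?barycenter_le.
Qed.

Lemma barycenter_surj (z : R) : m2 < z -> z <= m1 -> exists2 x, 0 <= x & bary x = z.
Proof.
move=> zl zr; exists ((m1 - z) / (z - m2)).
  by rewrite divr_ge0 ?subr_ge0// ltW.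
rewrite /barycenter; field; rewrite subr_eq0 (gt_eqF zl)/=.
by rewrite addrC subrKA subr_eq0 gt_eqF.
Qed.

Lemma barycenter_continuous (x : R) : 0 <= x -> bary y @[y --> x] --> bary x.
Proof.
move=> x0; apply: cvgM.
  by apply: cvgD; [exact: cvg_cst|apply: cvgM; [exact: cvg_id|exact: cvg_cst]].
apply: cvgV; first by rewrite gt_eqF ?gt0_1D.
by apply: cvgD; [exact: cvg_cst|exact: cvg_id].
Qed.

Let d_bary_continuous (m x : R) : M m -> 0 <= x ->
  d m (bary y) @[y --> x] --> d m (bary x).
Proof.
move=> mM x0; case: Hd => _ _ _ dc _.
apply: (cvg_comp _ _ (barycenter_continuous x0)).
by apply: dc => //; exact: barycenter_in.
Qed.

Lemma g_barycenterE (x : R) : 0 <= x -> g x = d m1 (bary x) + x * d m2 (bary x).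
Proof.
move=> x0; rewrite /Defs.g /I_; have x1 := gt_eqF (gt0_1D x0).
have -> : (1 + x)^-1 * m1 + (1 - (1 + x)^-1) * m2 = bary x.
  by rewrite /barycenter; field; rewrite x1.
by field; rewrite x1.
Qed.

(** So [g x] is the minimum of the left-hand side, attained at the barycenter
    only. *)
Lemma g_gap (x z : R) : 0 <= x -> M z ->
  d m1 z + x * d m2 z = g x + (1 + x) * d (bary x) z.
Proof.
move=> x0 zM; rewrite g_barycenterE// -[d m1 z]mul1r -[d m1 (bary x)]mul1r.
apply: (bregman_barycenter Hd) => //; first exact: barycenter_in.
by rewrite barycenterE// mul1r.
Qed.

Lemma g_le (x z : R) : 0 <= x -> M z -> g x <= d m1 z + x * d m2 z.
Proof.
move=> x0 zM; rewrite g_gap// lerDl mulr_ge0 ?(ltW (gt0_1D _))//.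
by apply: (bregman_ge0 Hd) => //; exact: barycenter_in.
Qed.

Let d2_gt0 (x : R) : 0 <= x -> 0 < d m2 (bary x).
Proof.
move=> x0; case: Hd => _ _ dpos _ _; rewrite dpos//; first exact: barycenter_in.
by rewrite lt_eqF// barycenter_gt.
Qed.

Let d1_ge0 (x : R) : 0 <= x -> 0 <= d m1 (bary x).
Proof. by move=> x0; exact: (bregman_ge0 Hd m1M (barycenter_in x0)). Qed.

(** A minimum of functions of [x] that increase strictly: the minimizer for [y]
    is a competitor for [x]. *)
Lemma g_increasing (x y : R) : 0 <= x -> x < y -> g x < g y.
Proof.
move=> x0 xy; have y0 := le_trans x0 (ltW xy).
apply: le_lt_trans (g_le x0 (barycenter_in y0)) _.
by rewrite (g_barycenterE y0) ltrD2l ltr_pM2r ?d2_gt0.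
Qed.

Lemma g_at0 : g 0 = 0.
Proof.
by rewrite g_barycenterE// mul0r addr0 barycenter0; case: Hd => _ d0 _ _ _; exact: d0.
Qed.

Lemma g_lt (x : R) : 0 <= x -> g x < d m1 m2.
Proof.
move=> x0; have [_ d0 dpos _ _] := Hd.
have := g_gap x0 m2M; rewrite d0// mulr0 addr0 => ->.
rewrite ltrDl mulr_gt0 ?gt0_1D// dpos//; first exact: barycenter_in.
by rewrite gt_eqF// barycenter_gt.
Qed.

(** Stands for the limit of [bary x] at infinity, which is [m2]. *)
Let bary_near_m2 (P : R -> Prop) : (\forall z \near m2, P z) ->
  exists x, 0 <= x /\ P (bary x).
Proof.
move=> nP; have : \forall z \near m2^'+, [/\ m2 < z, z < m1 & P z].
  near=> z; split.
  - by near: z; exact: nbhs_right_gt.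
  - by near: z; exact: nbhs_right_lt.
  - by near: z; exact: cvg_at_right_filter nP.
move=> /filter_ex[z [z2 z1 Pz]].
by have [x x0 xz] := barycenter_surj z2 (ltW z1); exists x; rewrite xz.
Unshelve. all: by end_near. Qed.

Lemma g_surj (y : R) : 0 <= y -> y < d m1 m2 -> exists2 x, 0 <= x & g x = y.
Proof.
move=> y0 yd; have [_ _ _ dc _] := Hd.
have [X [X0 yX]] := bary_near_m2 (cvgr_gt _ (dc _ _ m1M m2M) _ yd).
have gX : y <= g X.
  by rewrite g_barycenterE// (le_trans (ltW yX))// lerDl mulr_ge0// ltW// d2_gt0.
have gc : {within `[0, X], continuous g}.
  apply/subspace_continuousP => x xX.
  have x0 : 0 <= x by move: xX; rewrite /= in_itv/= => /andP[].
  change (g z @[z --> within `[0, X] (nbhs x)] --> g x).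
  rewrite g_barycenterE//; apply: (@cvg_trans _
    (d m1 (bary z) + z * d m2 (bary z) @[z --> within `[0, X] (nbhs x)])).
    apply: near_eq_cvg; rewrite near_withinE; near=> z.
    by rewrite /= in_itv/= => /andP[z0 _]; rewrite g_barycenterE.
  apply: cvg_within_filter.
  apply: cvgD; first exact: d_bary_continuous.
  by apply: cvgM; [exact: cvg_id|exact: d_bary_continuous].
have [|x] := @IVT _ g 0 X y X0 gc.
  by rewrite g_at0 ge_min y0/= le_max gX orbT.
by rewrite in_itv/= => /andP[x0 _] gxy; exists x.
Unshelve. all: by end_near. Qed.

Lemma g_invP (y : R) : 0 <= y -> y < d m1 m2 ->
  0 <= g_inv Theta nu m1 m2 y /\ g (g_inv Theta nu m1 m2 y) = y.
Proof.
move=> y0 yd; have [x x0 <-] := g_surj y0 yd.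
rewrite /g_inv pinvKV ?inE// => s t; rewrite !inE/= => s0 t0 e.
case: (ltgtP s t) => // st.
  by have := g_increasing s0 st; rewrite e ltxx.
by have := g_increasing t0 st; rewrite e ltxx.
Qed.

Lemma g_inv_continuous :
  {within `[0, d m1 m2[, continuous (g_inv Theta nu m1 m2)}.
Proof.
apply: (@within_continuous_inverse _ [set x | 0 <= x] _ g).
- move=> x y /= x0 _ z /andP[xz _]; exact: le_trans xz.
- by move=> s t /= s0 _; exact: g_increasing.
- by move=> y; rewrite /= in_itv/= => /andP[y0 yd]; exact: g_invP.
Qed.

Lemma g_inv_increasing (y z : R) : 0 <= y -> z < d m1 m2 -> y < z ->
  g_inv Theta nu m1 m2 y < g_inv Theta nu m1 m2 z.
Proof.
move=> y0 zd yz; have [iy gy] := g_invP y0 (lt_trans yz zd).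
have [iz gz] := g_invP (le_trans y0 (ltW yz)) zd.
move: yz; rewrite -{1}gy -{1}gz; apply: contraTT; rewrite -!leNgt.
rewrite le_eqVlt => /orP[/eqP -> //|/(g_increasing iz)]; exact: ltW.
Qed.

Lemma ratio_ge0 (x : R) : 0 <= x -> 0 <= ratio x.
Proof. by move=> x0; rewrite divr_ge0 ?d1_ge0// ltW ?d2_gt0. Qed.

Lemma ratio_increasing (x y : R) : 0 <= x -> x < y -> ratio x < ratio y.
Proof.
move=> x0 xy; have y0 := le_trans x0 (ltW xy).
have byx := barycenter_decreasing x0 xy.
have h1 : d m1 (bary x) < d m1 (bary y).
  by apply: (bregman_decreasing Hd) => //; [exact: barycenter_in..|exact: barycenter_le].
have h2 : d m2 (bary y) < d m2 (bary x).
  by apply: (bregman_increasing Hd) => //;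
    [exact: barycenter_in..|exact/ltW/barycenter_gt].
apply: (@le_lt_trans _ _ (d m1 (bary x) / d m2 (bary y))).
  by rewrite ler_wpM2l ?d1_ge0// lef_pV2 ?posrE ?d2_gt0// ltW.
by rewrite ltr_pM2r// invr_gt0 d2_gt0.
Qed.

Lemma ratio0 : ratio 0 = 0.
Proof. by rewrite barycenter0; case: Hd => _ -> // _ _ _; rewrite mul0r. Qed.

Lemma ratio_continuous (x : R) : 0 <= x -> ratio y @[y --> x] --> ratio x.
Proof.
move=> x0; apply: cvgM; first exact: d_bary_continuous.
by apply: cvgV; [rewrite gt_eqF ?d2_gt0|exact: d_bary_continuous].
Qed.

(** Near [m2] the numerator tends to [d m1 m2 > 0] and the denominator to 0. *)
Lemma ratio_unbounded A : exists2 X, 0 <= X & A < ratio X.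
Proof.
have [_ d0 dpos dc _] := Hd.
have D0 : 0 < d m1 m2 by rewrite dpos// gt_eqF.
(* It suffices that [d m1 z] exceeds half its limit while [d m2 z] is below that
   half divided by [B], which exceeds [A]. *)
pose B := `|A| + 1; have B0 : 0 < B by rewrite ltr_wpDl.
pose D2 := d m1 m2 / 2.
have D20 : 0 < D2 by rewrite divr_gt0.
have c1 : \forall z \near m2, D2 < d m1 z.
  apply: cvgr_gt (dc _ _ m1M m2M) _ _.
  by rewrite ltr_pdivrMr// ltr_pMr// ltr1n.
have c2 : \forall z \near m2, d m2 z < D2 / B.
  by apply: cvgr_lt (dc _ _ m2M m2M) _ _; rewrite d0// divr_gt0.
have [X [X0 [k1 k2]]] := bary_near_m2 (filterI c1 c2).
exists X => //; rewrite ltr_pdivlMr ?d2_gt0//.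
apply: le_lt_trans k1; rewrite (le_trans _ (_ : B * d m2 (bary X) <= _))//.
  by rewrite ler_pM2r ?d2_gt0// (le_trans (ler_norm _))// lerDl.
by rewrite mulrC -ler_pdivlMr// ltW.
Qed.

End two_arms.

(** * The function F *)

Section characteristic_function.
Context {R : realType} {K : nat}.
Variables (hK : (2 <= K)%N) (Theta : set R) (b : R -> R)
  (nu : R -> probability (measurableTypeR R) R) (mu : 'I_K -> R).
Local Notation d := (divergence Theta nu).
Local Notation M := (mean_space Theta b).
Local Notation one := (arm1 hK).
Local Notation two := (arm2 hK).
Hypothesis Hd : bregman_divergence M d.
Hypothesis muM : forall a, M (mu a).
Hypothesis mu21 : mu two < mu one.
Hypothesis mu_dec : forall a c : 'I_K, (a <= c)%N -> mu c <= mu a.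
Local Notation D := (d (mu one) (mu two)).
Local Notation bary a := (barycenter (mu one) (mu a)).
Local Notation ratio a x := (d (mu one) (bary a x) / d (mu a) (bary a x)).
Local Notation xinv a := (g_inv Theta nu (mu one) (mu a)).
Local Notation F := (F hK Theta nu mu).

Lemma mu_le_two a : a != one -> mu a <= mu two.
Proof.
move=> a1; apply: mu_dec; rewrite /= lt0n.
by apply: contra a1 => /eqP a0; apply/eqP/val_inj.
Qed.

Lemma mu_lt_one a : a != one -> mu a < mu one.
Proof. by move=> /mu_le_two/le_lt_trans; exact. Qed.

Lemma two_neq_one : two != one. Proof. by []. Qed.

(** The interval on which [F] is studied lies in the range of every [g], not only
    in that of the second arm. *)
Lemma two_arm_range_le a : a != one -> D <= d (mu one) (mu a).
Proof.
move=> /mu_le_two; rewrite le_eqVlt => /orP[/eqP -> //|a2].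
by apply/ltW/(bregman_decreasing Hd) => //; exact: ltW.
Qed.

Lemma F_sum y : F y = \sum_(a | a != one) ratio a (xinv a y).
Proof. by apply: eq_bigr => a /negbTE a1; rewrite /= /x_ a1. Qed.

Lemma xinvP a y : a != one -> 0 <= y -> y < D ->
  0 <= xinv a y /\ g Theta nu (mu one) (mu a) (xinv a y) = y.
Proof.
move=> a1 y0 yD; apply: (g_invP Hd) => //; first exact: mu_lt_one.
exact: lt_le_trans (two_arm_range_le a1).
Qed.

Lemma F_increasing y z : 0 <= y -> z < D -> y < z -> F y < F z.
Proof.
move=> y0 zD yz; have yD := lt_trans yz zD.
have incr a : a != one -> ratio a (xinv a y) < ratio a (xinv a z).
  move=> a1; apply: (ratio_increasing Hd) => //; first exact: mu_lt_one.
    by have [] := xinvP a1 y0 yD.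
  apply: (g_inv_increasing Hd) => //; first exact: mu_lt_one.
  exact: lt_le_trans (two_arm_range_le a1).
rewrite !F_sum !(bigD1 two two_neq_one)/= ltr_leD ?incr//.
by apply: ler_sum => a /andP[a1 _]; exact/ltW/incr.
Qed.

Lemma F_at0 : F 0 = 0.
Proof.
rewrite F_sum big1// => a a1; have m1a := mu_lt_one a1.
have D0 : 0 < d (mu one) (mu a).
  by case: Hd => _ _ dpos _ _; rewrite dpos// gt_eqF.
have [x0 gx] := g_invP Hd (muM one) (muM a) m1a (lexx 0) D0.
have -> : xinv a 0 = 0.
  apply/eqP; rewrite eq_sym eq_le x0/= leNgt; apply/negP => xpos.
  have := g_increasing Hd (muM one) (muM a) m1a (lexx 0) xpos.
  by rewrite gx (g_at0 Hd _ (muM one)) ltxx.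
exact: (ratio0 Hd _ (muM one)).
Qed.

(** Each summand is a continuous ratio composed with the inverse of [g], which is
    continuous up to the end point 0. *)
Lemma F_continuous : {within `[0, D[, continuous F}.
Proof.
apply/subspace_continuousP => y yD.
have [y0 yltD] : 0 <= y /\ y < D by move: yD; rewrite /= in_itv/= => /andP[].
change (F z @[z --> within `[0, D[ (nbhs y)] --> F y).
have -> : F = fun z => \sum_(a | a != one) ratio a (xinv a z).
  by apply/funext => z; exact: F_sum.
apply: cvg_big => [|a a1]; first exact: add_continuous.
have m1a := mu_lt_one a1.
apply: (cvg_comp (xinv a) (fun x => ratio a x)
   (_ : _ --> xinv a y)); last first.
  apply: (ratio_continuous Hd) => //.
  by have [] := xinvP a1 y0 yltD.
have := g_inv_continuous Hd (muM one) (muM a) m1a.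
move=> /(continuous_subspaceW (_ : `[0, D[ `<=` _)) /subspace_continuousP; apply => //.
move=> z; rewrite /= !in_itv/= => /andP[-> zD]/=.
exact: lt_le_trans (two_arm_range_le a1).
Qed.

(** The summand of the second arm diverges and the others are nonnegative. *)
Lemma F_unbounded : F y @[y --> D^'-] --> +oo.
Proof.
apply/cvgryPgt => A.
have [X X0 AX] := ratio_unbounded Hd (muM one) (muM two) mu21 A.
have gX := g_lt Hd (muM one) (muM two) mu21 X0.
near=> y.
have gy : g Theta nu (mu one) (mu two) X < y by near: y; exact: nbhs_left_gt.
have yD : y < D by near: y; exact: nbhs_left_lt.
have y0 : 0 <= y.
  apply: le_trans (ltW gy); rewrite -(g_at0 Hd (mu two) (muM one)).
  move: X0; rewrite le_eqVlt => /orP[/eqP <- //|X0].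
  exact/ltW/(g_increasing Hd).
rewrite F_sum (bigD1 two two_neq_one)/=.
have [x0 gx] := xinvP two_neq_one y0 yD.
apply: lt_le_trans (_ : ratio two (xinv two y) <= _).
  apply: lt_trans AX _; apply: (ratio_increasing Hd) => //.
  rewrite ltNge; apply/negP; rewrite le_eqVlt => /orP[/eqP e|].
    by move: gy; rewrite -e gx ltxx.
  move=> /(g_increasing Hd (muM one) (muM two) mu21 x0).
  by rewrite gx ltNge ltW.
rewrite lerDl sumr_ge0// => a /andP[a1 _].
apply: (ratio_ge0 Hd) => //; first exact: mu_lt_one.
by have [] := xinvP a1 y0 yD.
Unshelve. all: by end_near. Qed.

Lemma F_reaches1 : exists y, [/\ 0 < y, y < D & F y = 1].
Proof.
have D0 : 0 < D by case: Hd => _ _ dpos _ _; rewrite dpos// gt_eqF.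
have : \forall Y \near D^'-, [/\ 0 < Y, Y < D & 1 < F Y].
  near=> Y; split; near: Y.
  - exact: nbhs_left_gt.
  - exact: nbhs_left_lt.
  - by move/cvgryPgt : F_unbounded; exact.
move=> /filter_ex[Y [Y0 YD FY]].
have [||y] := @IVT _ F 0 Y 1 (ltW Y0).
- apply: continuous_subspaceW F_continuous => y/=.
  by rewrite !in_itv/= => /andP[-> /le_lt_trans]; exact.
- by rewrite F_at0 ge_min ler01/= le_max (ltW FY) orbT.
rewrite in_itv/= => /andP[y0 yY] Fy; exists y; split => //.
  rewrite lt_neqAle y0 andbT; apply/eqP => y0'.
  by move: Fy; rewrite -y0' F_at0 => /eqP; rewrite eq_sym oner_eq0.
exact: le_lt_trans YD.
Unshelve. all: by end_near. Qed.

End characteristic_function.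

(** * Optimal weights *)

Section optimal_weights.
Context {R : realType} {K : nat}.
Variables (hK : (2 <= K)%N) (Theta : set R) (b : R -> R)
  (nu : R -> probability (measurableTypeR R) R) (mu : 'I_K -> R).
Local Notation d := (divergence Theta nu).
Local Notation M := (mean_space Theta b).
Local Notation one := (arm1 hK).
Local Notation two := (arm2 hK).
Hypothesis Hd : bregman_divergence M d.
Hypothesis muM : forall a, M (mu a).
Hypothesis mu21 : mu two < mu one.
Hypothesis mu_dec : forall a c : 'I_K, (a <= c)%N -> mu c <= mu a.
Local Notation objective := (objective hK Theta b nu mu).
Implicit Types (w : 'I_K -> R) (a : 'I_K).

Let mu_lt a : a != one -> mu a < mu one.
Proof. exact: mu_lt_one. Qed.

Lemma astar_eq (lam : 'I_K -> R) a :
  (forall c, c != a -> lam c < lam a) -> astar hK lam = a.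
Proof.
move=> lama; rewrite /astar; case: arg_maxP => // c _ /(_ a isT) lac.
by apply/eqP; apply: contraTT lac => /lama; rewrite -ltNge.
Qed.

(** In an alternative model [lam one <= lam a] for the best arm [a].  Moving both
    means to a point between them that is as close as possible to the segment from
    [mu a] to [mu one] does not increase either cost. *)
Lemma objective_ge w v : (forall a, 0 <= w a) ->
  (forall a x, a != one -> M x -> v <= w one * d (mu one) x + w a * d (mu a) x) ->
  (v%:E <= objective w)%E.
Proof.
move=> w0 hv; apply/ereal_infP => _ [lam [[lamM _] lam1] <-].
rewrite lee_fin; rewrite (astar_eq (lam := mu) (a := one)) in lam1; last by move=> c /mu_lt.
set a := astar hK lam in lam1; have {lam1}a1 : a != one by exact/eqP.
have lam1a : lam one <= lam a.
  by rewrite /a /astar; case: arg_maxP => // c _; exact.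
have dge c : 0 <= w c * d (mu c) (lam c).
  by rewrite mulr_ge0// (bregman_ge0 Hd).
rewrite (bigD1 one)//= (bigD1 a)//= addrA.
apply: (@le_trans _ _ (w one * d (mu one) (lam one) + w a * d (mu a) (lam a))); last first.
  by rewrite lerDl sumr_ge0.
have dincr m x y : M m -> M x -> M y -> m <= x -> x <= y -> d m x <= d m y.
  move=> mM xM yM mx; rewrite le_eqVlt => /orP[/eqP -> //|xy].
  exact/ltW/(bregman_increasing Hd).
have ddecr m x y : M m -> M x -> M y -> x <= m -> y <= x -> d m x <= d m y.
  move=> mM xM yM mx; rewrite le_eqVlt => /orP[/eqP -> //|xy].
  exact/ltW/(bregman_decreasing Hd).
have ma1 := ltW (mu_lt a1).
have [la1|l1a] := leP (lam a) (mu one).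
  apply: le_trans (hv _ _ a1 (lamM a)) _.
  by rewrite lerD2r ler_wpM2l// ddecr.
have [l11|l11] := leP (mu one) (lam one).
  apply: le_trans (hv _ _ a1 (lamM one)) _.
  by rewrite lerD2l ler_wpM2l// dincr// (le_trans ma1).
apply: le_trans (hv _ _ a1 (muM one)) _.
apply: lerD; apply: ler_wpM2l => //.
  by apply: ddecr => //; exact: ltW.
by apply: dincr => //; exact: ltW.
Qed.

(** Put arms 1 and [a] at the mean [x] and leave the others: arm 1 is not strictly
    the best, but the best arm may be tied, which [Alt] excludes.  Raising the best
    of the arms other than 1 by an arbitrarily small amount breaks the tie at an
    arbitrarily small cost. *)
Lemma objective_le w a x : a != one -> M x ->
  (objective w <= (w one * d (mu one) x + w a * d (mu a) x)%:E)%E.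
Proof.
move=> a1 xM; have [[oM _] d0 _ dc _] := Hd.
apply/lee_addgt0Pr => e e0.
pose base c := if (c == one) || (c == a) then x else mu c.
have baseM c : M (base c) by rewrite /base; case: ifP.
have [c0 c01 c0max] : exists2 c0, c0 != one & forall c, base c <= base c0.
  pose c0 := [arg max_(c > a | c != one) base c]%O.
  have [c01 c0max] : c0 != one /\ forall c, c != one -> base c <= base c0.
    by rewrite /c0; case: arg_maxP => // c.
  exists c0 => // c; have [->|/c0max//] := eqVneq c one.
  by apply: le_trans (c0max _ a1); rewrite /base !eqxx orbT.
have nearM : \forall z \near base c0, M z.
  exact: open_nbhs_nbhs (conj oM (baseM c0)).
have near_cost : \forall z \near base c0,
    w c0 * d (mu c0) z < w c0 * d (mu c0) (base c0) + e.
  have cost_cvg : w c0 * d (mu c0) t @[t --> base c0]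
      --> w c0 * d (mu c0) (base c0).
    by apply: cvgM; [exact: cvg_cst|exact: dc].
  by apply: cvgr_lt cost_cvg _ _; rewrite ltrDl.
have : \forall z \near (base c0)^'+, [/\ base c0 < z, M z &
    w c0 * d (mu c0) z < w c0 * d (mu c0) (base c0) + e].
  near=> z; split; near: z.
  - exact: nbhs_right_gt.
  - exact: cvg_at_right_filter nearM.
  - exact: cvg_at_right_filter near_cost.
move=> /filter_ex[z [zbig zM zval]].
(* [c0] exceeds all arms strictly once it is raised to [z]. *)
pose lam c := if c == c0 then z else base c.
have lamlt c : c != c0 -> lam c < lam c0.
  by move=> cc0; rewrite /lam eqxx (negbTE cc0) (le_lt_trans (c0max c)).
apply: ge_ereal_inf.
exists (\sum_c w c * d (mu c) (lam c))%:E.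
  exists lam => //; split; last first.
    rewrite (astar_eq lamlt) (astar_eq (lam := mu) (a := one)); last by move=> c /mu_lt.
    exact/eqP.
  split; first by move=> c; rewrite /lam; case: ifP.
  exists c0; split=> [c|c cmax].
    by have [->//|/lamlt/ltW] := eqVneq c c0.
  by apply/eqP; rewrite eq_sym; apply: contraT => /lamlt; rewrite ltNge cmax.
rewrite -EFinD lee_fin.
have -> : w one * d (mu one) x + w a * d (mu a) x
    = \sum_c w c * d (mu c) (base c).
  rewrite (bigD1 one)//= (bigD1 a)//= big1 ?addr0; last first.
    by move=> c /andP[/negbTE c1 /negbTE ca]; rewrite /base c1 ca/= d0 ?mulr0.
  by rewrite /base !eqxx orbT.
rewrite (bigD1 c0)//= [in leRHS](bigD1 c0)//= addrAC lerD//.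
  by rewrite /lam eqxx ltW.
by apply: ler_sum => c /negbTE cc0; rewrite /lam cc0.
Unshelve. all: by end_near. Qed.

Variable y : R.
Local Notation D := (d (mu one) (mu two)).
Hypotheses (y0 : 0 < y) (yD : y < D) (Fy : F hK Theta nu mu y = 1).
Local Notation x a := (x_ hK Theta nu mu a y).
Local Notation z a := (barycenter (mu one) (mu a) (x a)).
Let S := \sum_i x i.
Local Notation wopt := (fun a => x a / S).

Let x1 : x one = 1. Proof. by rewrite /x_ eqxx. Qed.

Let xP a : a != one ->
  0 <= x a /\ g Theta nu (mu one) (mu a) (x a) = y.
Proof.
move=> a1; rewrite /x_ (negbTE a1).
by apply: (xinvP Hd) => //; exact: ltW.
Qed.

Let x_ge0 a : 0 <= x a.
Proof. by have [->|/xP[]] := eqVneq a one; rewrite ?x1. Qed.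

Let S_gt0 : 0 < S.
Proof.
rewrite /S (bigD1 one)//= x1 ltr_pwDl//.
by apply: sumr_ge0.
Qed.

Let zM a : a != one -> M (z a).
Proof. by move=> a1; apply: (barycenter_in Hd) => //; exact: mu_lt. Qed.

Let z_gt a : a != one -> mu a < z a.
Proof. by move=> a1; apply: barycenter_gt => //; exact: mu_lt. Qed.

Let e a := d (mu a) (z a).
Let e_gt0 a : a != one -> 0 < e a.
Proof.
move=> a1; case: Hd => _ _ dpos _ _; apply: dpos => //; first exact: zM.
by rewrite lt_eqF// z_gt.
Qed.

(** On the left [w one] has the coefficient [F y], which is 1. *)
Lemma weighted_costs w :
  \sum_(a | a != one) (w one * d (mu one) (z a) + w a * e a) / e a = \sum_a w a.
Proof.
rewrite [RHS](bigD1 one)//=.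
rewrite -[X in X + _]mulr1 -[in X in X + _]Fy mulr_sumr -big_split/=.
apply: eq_bigr => a a1; rewrite mulrDl mulfK ?gt_eqF ?e_gt0//.
by rewrite mulrA.
Qed.

Lemma wopt_simplex : simplex wopt.
Proof.
split=> [a|]; first by rewrite divr_ge0// ltW.
by rewrite -mulr_suml divff// gt_eqF.
Qed.

Lemma wopt_cost a : a != one ->
  wopt one * d (mu one) (z a) + wopt a * e a = y / S.
Proof.
move=> a1; have [xa0 ga] := xP a1.
transitivity (g Theta nu (mu one) (mu a) (x a) / S); last by rewrite ga.
by rewrite g_barycenterE// x1 /e; ring.
Qed.

Let P := \sum_(a | a != one) (e a)^-1.

(** The pair costs of [wopt] all equal [y / S], so this is [weighted_costs] at
    [wopt]. *)
Lemma wopt_value : (y / S) * P = 1.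
Proof.
have [_ <-] := wopt_simplex; rewrite -weighted_costs mulr_sumr.
by apply: eq_bigr => a a1; rewrite wopt_cost.
Qed.

Lemma objective_wopt_ge : ((y / S)%:E <= objective wopt)%E.
Proof.
apply: objective_ge => [a|a t a1 tM]; first by case: wopt_simplex.
have [xa0 ga] := xP a1.
have := g_le Hd (muM one) (muM a) (mu_lt a1) xa0 tM; rewrite ga => yle.
rewrite x1 (_ : _ + _ = (d (mu one) t + x a * d (mu a) t) / S); last by ring.
by rewrite ler_pM2r ?invr_gt0.
Qed.

(** Otherwise all pair costs at the points [z a] would exceed [y / S], and so
    would their weighted mean. *)
Lemma objective_le_wopt w : simplex w -> (objective w <= (y / S)%:E)%E.
Proof.
move=> [w0 w1]; rewrite leNgt; apply/negP => lt.
suff : 1 < \sum_a w a by rewrite w1 ltxx.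
rewrite -weighted_costs -wopt_value mulr_sumr.
apply: ltr_sum; first by apply/hasP; exists two; rewrite ?mem_index_enum.
move=> a a1; rewrite ltr_pM2r ?invr_gt0 ?e_gt0// -lte_fin.
exact: lt_le_trans lt (objective_le _ a1 (zM a1)).
Qed.

(** Every pair cost of [w] is at least [y / S] and their weighted mean equals it, so
    each [z a] minimizes the pair cost of [a]: it is the barycenter for the weights
    [w one] and [w a], as well as for [1] and [x a]. *)
Lemma wstar_unique w : wstar hK Theta b nu mu w -> w = wopt.
Proof.
move=> [[w0 w1] wmax].
have wge : ((y / S)%:E <= objective w)%E.
  exact: le_trans objective_wopt_ge (wmax _ wopt_simplex).
have cge a t : a != one -> M t ->
    y / S <= w one * d (mu one) t + w a * d (mu a) t.
  move=> a1 tM; rewrite -lee_fin; exact: le_trans wge (objective_le _ a1 tM).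
have ceq a : a != one -> w one * d (mu one) (z a) + w a * e a = y / S.
  move=> a1; apply/eqP; rewrite eq_le (cge _ _ a1 (zM a1)) andbT leNgt; apply/negP => lt.
  suff : 1 < \sum_a w a by rewrite w1 ltxx.
  rewrite -weighted_costs -wopt_value mulr_sumr.
  rewrite (bigD1 a)// [ltRHS](bigD1 a)//= ltr_leD//.
    by rewrite ltr_pM2r ?invr_gt0 ?e_gt0.
  by apply: ler_sum => c /andP[c1 _]; rewrite ler_pM2r ?invr_gt0 ?e_gt0//; exact: cge (zM c1).
(* The ratio of the weights is read off their barycenter with [mu one]. *)
have wx a : w a = w one * x a.
  have [->|a1] := eqVneq a one; first by rewrite x1 mulr1.
  have W0 : 0 < w one + w a.
    rewrite lt_neqAle addr_ge0// andbT eq_sym; apply/eqP => W0.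
    (* Two zero weights would give the pair cost 0, whereas [y / S > 0]. *)
    have [wone0 wa0] : w one = 0 /\ w a = 0 by have := w0 one; have := w0 a; lra.
    have := ceq _ a1; rewrite wone0 wa0 !mul0r addr0 => /eqP.
    by rewrite eq_sym gt_eqF// divr_gt0.
  pose m := (w one * mu one + w a * mu a) / (w one + w a).
  have Wm : w one * mu one + w a * mu a = (w one + w a) * m.
    by rewrite [RHS]mulrC divfK// gt_eqF.
  have mM : M m.
    case: Hd => -[_ iM] _ _ _ _; apply: (iM (mu a) (mu one)) => //.
    have ma1 := mu_lt a1.
    rewrite /m ler_pdivlMr// ler_pdivrMr//.
    have h1 : 0 <= w one * (mu one - mu a) by rewrite mulr_ge0// subr_ge0 ltW.
    have h2 : 0 <= w a * (mu one - mu a) by rewrite mulr_ge0// subr_ge0 ltW.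
    by apply/andP; split; lra.
  have mz : m = z a.
    apply/eqP; apply: contraT => mz; case: Hd => _ _ dpos _ _.
    have := bregman_barycenter Hd (muM one) (muM a) mM (zM a1) Wm.
    rewrite ceq// => ez; have := cge _ _ a1 mM.
    by rewrite leNgt ez ltrDl mulr_gt0// dpos//; exact: zM.
  have zx := barycenterE (mu one) (mu a) (x_ge0 a).
  have za : z a - mu a != 0 by rewrite subr_eq0 gt_eqF// z_gt.
  apply: (mulIf za).
  transitivity (w one * (mu one - z a)).
    by rewrite -mz; move: Wm; lra.
  by rewrite -mulrA; congr (_ * _); move: zx; lra.
have w1S : w one * S = 1.
  by rewrite -w1 mulr_sumr; apply: eq_bigr => a _; rewrite -wx.
apply/funext => a; rewrite wx mulrC -[RHS]mulr1 -w1S.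
by field; rewrite gt_eqF.
Qed.

Lemma wstarE : wstar hK Theta b nu mu = [set wopt].
Proof.
apply/seteqP; split=> [w /wstar_unique -> //|_ ->].
split; first exact: wopt_simplex.
by move=> v /objective_le_wopt/le_trans; apply; exact: objective_wopt_ge.
Qed.

End optimal_weights.

Theorem theorem5 (R : realType) (K : nat) (hK : (2 <= K)%N)
  (Theta : set R) (xi : {measure set (measurableTypeR R) -> \bar R})
  (b : R -> R) (nu : R -> probability (measurableTypeR R) R)
  (hfam : exponential_family Theta xi b nu)
  (mu : 'I_K -> R)
  (hmu : forall a, mean_space Theta b (mu a))
  (hmu12 : mu (arm2 hK) < mu (arm1 hK))
  (hmu_dec : forall a c : 'I_K, (a <= c)%N -> mu c <= mu a) :
  let D := divergence Theta nu (mu (arm1 hK)) (mu (arm2 hK)) in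
  let Fmu := F hK Theta nu mu in
  [/\ {within `[0, D[, continuous Fmu},
      {in `[0, D[ &, {homo Fmu : y z / y < z}},
      Fmu 0 = 0,
      Fmu y @[y --> D^'-] --> +oo &
      exists ystar : R,
        [/\ ystar \in `[0, D[,
            Fmu ystar = 1,
            forall y, y \in `[0, D[ -> Fmu y = 1 -> y = ystar &
            wstar hK Theta b nu mu =
              [set (fun a => x_ hK Theta nu mu a ystar
                             / \sum_i x_ hK Theta nu mu i ystar)]]].
Proof.
have Hd : bregman_divergence (mean_space Theta b) (divergence Theta nu).
  apply: expfam_bregman hfam _.
  exists (mu (arm1 hK)), (mu (arm2 hK)); split => //.
  by apply/eqP; rewrite gt_eqF.
move=> D Fmu.
have Fincr := F_increasing Hd hmu hmu12 hmu_dec.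
have [y [y0 yD Fy]] := F_reaches1 Hd hmu hmu12 hmu_dec; rewrite -/Fmu in Fy.
have inD t : t \in `[0, D[ -> 0 <= t /\ t < D.
  by rewrite inE/= in_itv/= => /andP.
split.
- exact: (F_continuous Hd hmu hmu12 hmu_dec).
- by move=> s t /inD[s0 _] /inD[_ tD]; exact: Fincr.
- exact: (F_at0 Hd hmu hmu12 hmu_dec).
- exact: (F_unbounded Hd hmu hmu12 hmu_dec).
exists y; split => //.
- by rewrite inE/= in_itv/= yD ltW.
- move=> t /inD[t0 tD] Ft; case: (ltgtP t y) => // ty.
    by have : Fmu t < Fmu y := Fincr _ _ t0 yD ty; rewrite Ft Fy ltxx.
  by have : Fmu y < Fmu t := Fincr _ _ (ltW y0) tD ty; rewrite Ft Fy ltxx.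
- exact: (wstarE Hd hmu hmu12 hmu_dec y0 yD Fy).
Qed.
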